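(* Let $\Delta\ge 3$ be an integer, let $\lambda_\Delta:=\frac{(\Delta-1)^{\Delta-1}}{(\Delta-2)^{\Delta}}$, and let $D_\Delta\subseteq\mathbb{C}$ be any neighborhood (in $\mathbb{C}$) of the interval $[0,\lambda_\Delta)$. Then there exist a graph $G=(V,E)$ of maximum degree at most $\Delta$ and $\lambda\in D_\Delta^V$ such that $Z_G(\lambda)=0$.
   Context: Graphs are finite and simple. For a graph $G=(V,E)$ and $\lambda=(\lambda_v)_{v\in V}\in\mathbb{C}^V$, the multivariate independence polynomial is $Z_G(\lambda)=\sum_{I}\prod_{v\in I}\lambda_v$, where the sum is over all independent sets $I\subseteq V$ (sets spanning no edge of $G$, including the empty set). *)

(* Defs.v *)
From HB Require Import structures.
From mathcomp Require Import all_boot all_order all_algebra.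
From mathcomp Require Import all_classical all_reals all_analysis.
From mathcomp Require Import complex.

Set Implicit Arguments.
Unset Strict Implicit.
Unset Printing Implicit Defensive.

Import Order.TTheory GRing.Theory Num.Theory.
Import numFieldNormedType.Exports.

Local Open Scope classical_set_scope.
Local Open Scope ring_scope.
Local Open Scope complex_scope.

Record sgraph := SGraph {
  vertex :> finType;
  adj : rel vertex;
  adj_sym : symmetric adj;
  adj_irr : irreflexive adj }.

Section Graph.
Variable G : sgraph.

Definition degree (v : G) : nat := #|[set w : G | adj v w]%SET|.

Definition max_degree : nat := (\max_(v : G) degree v)%N.

Definition independent (I : {set G}) : bool :=
  [forall u in I, forall v in I, ~~ adj u v].

Definition indep_poly (R : comNzRingType) (lam : G -> R) : R :=
  \sum_(I : {set G} | independent I) \prod_(v in I) lam v.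

End Graph.

Definition lambda_crit (R : realType) (Delta : nat) : R :=
  (Delta%:R - 1) ^+ (Delta - 1) / (Delta%:R - 2) ^+ Delta.

(* The topology of C is that of the modulus; the library attaches it to the
   copy R[i]^o of R[i], hence the type of this set. *)
Definition real_seg (R : realType) (b : R) : set R[i]^o :=
  [set x%:C | x in `[0, b[%classic].

(* Main.v *)
Require Import Defs.
From mathcomp Require Import all_boot all_order all_algebra.
From mathcomp Require Import all_classical all_reals all_analysis.
From mathcomp Require Import complex ring lra.
Import Order.TTheory GRing.Theory Num.Theory.
Import numFieldNormedType.Exports.
Local Open Scope classical_set_scope.
Local Open Scope ring_scope.
Local Open Scope complex_scope.
Set Implicit Arguments.
Unset Strict Implicit.
Unset Printing Implicit Defensive.

(** Write d = Delta - 1 and let lc be the critical value d^d / (d-1)^(d+1).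
    In a tree, the ratio z of the weight of the independent sets that contain
    the root to the weight of those that avoid it obeys the recursion
    z -> t / (1 + z)^d, where t is the parameter at a new root with d children
    of ratio z ([ratio_step]); the partition function vanishes as soon as the
    ratio -1 is attained ([ratioN1]).

    All the points used have the form [apex a b]: the point z with argument b
    for which 1 + z has argument a.  By the law of sines in the triangle with
    vertices -1, 0, z, both |z| and |1 + z| are quotients of sines.  Consider
    the curve z(x) = [apex x (d x)], for 0 < x <= pi / d.  The map
    z -> t / (1 + z)^d with real t sends z(x) to its conjugate exactly when
    t = sin x sin(d x)^d / sin((d-1) x)^(d+1), and this number is strictly
    less than its limit lc at x = 0 ([sine_product_lt]).  Hence there is room
    to vary t: two real steps below lc lead from z(x) to z(y) for every y
    close enough to x ([ratio_apex_near]).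

    The curve tends to 1 / (d-1) as x tends to 0.  This is a point of the real
    interval, because 1 / (d-1) < lc, so z(x) belongs to D for small x and is
    the ratio of a single vertex ([initial_apex]).  From there, real parameters
    in [0, lc) move the ratio along the whole curve, by compactness
    ([segment_induction]), up to its other end z(pi / d) = -1. *)

(** * Joining two graphs by an edge *)

Section Graft.
Variables (G H : sgraph) (u : G) (v : H).

Definition graft_adj : rel (G + H) := fun x y =>
  match x, y with
  | inl a, inl b => adj a b
  | inr a, inr b => adj a b
  | inl a, inr b => (a == u) && (b == v)
  | inr b, inl a => (a == u) && (b == v)
  end.

Lemma graft_sym : symmetric graft_adj.
Proof. by move=> [a|a] [b|b] //=; rewrite adj_sym. Qed.

Lemma graft_irr : irreflexive graft_adj.
Proof. by move=> [a|a] /=; rewrite adj_irr. Qed.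

Definition graft : sgraph := SGraph graft_sym graft_irr.

Definition graft_set (p : {set G} * {set H}) : {set graft} :=
  [set x | match x with inl a => a \in p.1 | inr b => b \in p.2 end]%SET.

Lemma graft_set_bij : bijective graft_set.
Proof.
exists (fun I : {set graft} => ([set a | inl a \in I], [set b | inr b \in I])%SET).
  by move=> [A B]; congr (_, _); apply/setP => x; rewrite !inE.
by move=> I; apply/setP => -[x|x]; rewrite !inE.
Qed.

Lemma independent_graft A B : independent (graft_set (A, B)) =
  [&& independent A, independent B & ~~ ((u \in A) && (v \in B))].
Proof.
apply/idP/idP.
  move/forall_inP => h; apply/and3P; split.
  - apply/forall_inP => a aA; apply/forall_inP => b bA.
    have /forall_inP/(_ (inl b)) := h (inl a) ltac:(by rewrite inE).
    by rewrite inE; apply.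
  - apply/forall_inP => a aA; apply/forall_inP => b bA.
    have /forall_inP/(_ (inr b)) := h (inr a) ltac:(by rewrite inE).
    by rewrite inE; apply.
  - apply/negP => /andP[uA vB].
    have /forall_inP/(_ (inr v)) := h (inl u) ltac:(by rewrite inE).
    by rewrite inE /= !eqxx => /(_ vB).
case/and3P => /forall_inP hA /forall_inP hB huv.
apply/forall_inP => -[a|a]; rewrite inE /= => ha;
  apply/forall_inP => -[b|b]; rewrite inE /= => hb.
- by move/forall_inP: (hA _ ha); apply.
- by apply: contra huv => /andP[/eqP<- /eqP<-]; apply/andP.
- by apply: contra huv => /andP[/eqP<- /eqP<-]; apply/andP.
- by move/forall_inP: (hB _ ha); apply.
Qed.

Variables (C : comNzRingType) (lamG : G -> C) (lamH : H -> C).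

Definition graft_weight (x : graft) : C :=
  match x with inl a => lamG a | inr b => lamH b end.

Lemma prod_graft_set A B :
  \prod_(x in graft_set (A, B)) graft_weight x =
  (\prod_(a in A) lamG a) * \prod_(b in B) lamH b.
Proof.
rewrite big_sumType /=; congr (_ * _).
  by apply: eq_bigl => a; rewrite inE.
by apply: eq_bigl => a; rewrite inE.
Qed.

Lemma degree_graft_l a : degree (inl a : graft) = (degree a + (a == u))%N.
Proof.
rewrite /degree -!sum1_card big_sumType /=; congr (_ + _)%N.
  by apply: eq_bigl => b; rewrite !inE.
rewrite (eq_bigl (fun b => (a == u) && (b == v))); last by move=> b; rewrite !inE.
by case: (a == u) => /=; rewrite ?big_pred1_eq ?big_pred0_eq.
Qed.

Lemma degree_graft_r b : degree (inr b : graft) = (degree b + (b == v))%N.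
Proof.
rewrite /degree -!sum1_card big_sumType /= addnC; congr (_ + _)%N.
  by apply: eq_bigl => a; rewrite !inE.
rewrite (eq_bigl (fun a => (a == u) && (b == v))); last by move=> a; rewrite !inE.
under eq_bigl do rewrite andbC.
by case: (b == v) => /=; rewrite ?big_pred1_eq ?big_pred0_eq.
Qed.

End Graft.

(** * Partition functions of rooted graphs *)

Section Rooted.
Variables (C : comNzRingType) (G : sgraph) (u : G) (lam : G -> C).
Definition Zout := \sum_(I : {set G} | independent I && (u \notin I)) \prod_(v in I) lam v.
Definition Zin := \sum_(I : {set G} | independent I && (u \in I)) \prod_(v in I) lam v.

Lemma indep_poly_root : indep_poly lam = Zout + Zin.
Proof. by rewrite /indep_poly (bigID (fun I : {set G} => u \in I)) /= addrC. Qed.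
End Rooted.

Section GraftZ.
Variables (C : comNzRingType) (G H : sgraph) (u : G) (v : H).
Variables (lamG : G -> C) (lamH : H -> C).
Let lam : graft u v -> C := graft_weight lamG lamH.

Lemma Zout_graft : Zout (inl u : graft u v) lam = Zout u lamG * indep_poly lamH.
Proof.
rewrite /Zout /indep_poly (reindex (graft_set u v)); last exact: onW_bij (graft_set_bij u v).
rewrite big_distrlr /= pair_big_dep /=; apply: eq_big => -[A B] /=.
  rewrite independent_graft inE /=.
  by case: (u \in A); rewrite ?andbF ?andbT //.
by rewrite prod_graft_set.
Qed.

Lemma Zin_graft : Zin (inl u : graft u v) lam = Zin u lamG * Zout v lamH.
Proof.
rewrite /Zin /Zout (reindex (graft_set u v)); last exact: onW_bij (graft_set_bij u v).
rewrite big_distrlr /= pair_big_dep /=; apply: eq_big => -[A B] /=.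
  rewrite independent_graft inE /=.
  by case: (u \in A); rewrite ?andbF ?andbT //= andbA.
by rewrite prod_graft_set.
Qed.
End GraftZ.

Definition point : sgraph := @SGraph unit (fun _ _ => false) (fun _ _ => erefl) (fun _ => erefl).

Lemma Z_point (C : comNzRingType) (l : C) :
  Zout (tt : point) (fun _ => l) = 1 /\ Zin (tt : point) (fun _ => l) = l.
Proof.
have indep (I : {set point}) : independent I.
  by apply/forall_inP => x _; apply/forall_inP.
split; rewrite /Zout /Zin.
  rewrite (big_pred1 (finset.set0 : {set point})) ?big_set0// => I.
  rewrite indep; apply/idP/eqP => [h|->]; last by rewrite inE.
  by apply/setP => -[]; rewrite inE; exact/negbTE.
rewrite (big_pred1 ([set tt]%SET : {set point})) ?big_set1// => I.
rewrite indep; apply/idP/eqP => [h|->]; last by rewrite inE.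
by apply/setP => -[]; rewrite inE.
Qed.

(** * Ratios realizable with bounded degree *)

Section Realizable.
Variables (C : comNzRingType) (D : C -> Prop) (m : nat).

(** The bound [j] on the degree of the root, apart from the bound [m] on all
    degrees, tells how many more edges can be attached to the root. *)
Definition realizable (j : nat) (a b : C) : Prop :=
  exists (G : sgraph) (u : G) (lam : G -> C),
    [/\ forall v : G, (degree v <= m)%N, (degree u <= j)%N,
        forall v, D (lam v), Zout u lam = a & Zin u lam = b].

Lemma realizable_point l : D l -> realizable 0 1 l.
Proof.
move=> Dl; have [Zo Zi] := Z_point l.
have deg0 (v : point) : degree v = 0%N by apply: eq_card0 => w; rewrite !inE.
by exists point, (tt : point), (fun _ => l); split=> // *; rewrite deg0.
Qed.

Lemma realizable_graft j j' a b a' b' : (j < m)%N -> (j' < m)%N ->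
  realizable j a b -> realizable j' a' b' ->
  realizable j.+1 (a * (a' + b')) (b * a').
Proof.
move=> jm j'm [G [u [lamG [degG degu DG <- <-]]]] [H [v [lamH [degH degv DH <- <-]]]].
exists (graft u v), (inl u), (graft_weight lamG lamH); split.
- case=> w; rewrite ?degree_graft_l ?degree_graft_r; case: eqP => [->|_].
  + by rewrite addn1; exact: leq_ltn_trans jm.
  + by rewrite addn0.
  + by rewrite addn1; exact: leq_ltn_trans j'm.
  + by rewrite addn0.
- by rewrite degree_graft_l eqxx addn1.
- by case.
- by rewrite Zout_graft (indep_poly_root v).
- by rewrite Zin_graft.
Qed.

(** A new root of parameter [l], to which [n] copies of the given rooted graph
    are attached one at a time. *)
Lemma realizable_tree j n a b l : (j < m)%N -> (n <= m)%N -> D l ->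
  realizable j a b -> realizable n ((a + b) ^+ n) (l * a ^+ n).
Proof.
move=> jm nm Dl rab; elim: n nm => [|n IHn] nm.
  by rewrite !expr0 mulr1; exact: realizable_point.
by rewrite !exprSr mulrA; apply: realizable_graft jm _ rab => //; apply: IHn; exact: ltnW.
Qed.

Lemma realizable_max_degree j a b : realizable j a b ->
  exists (G : sgraph) (lam : G -> C),
    [/\ (max_degree G <= m)%N, forall v, D (lam v) & indep_poly lam = a + b].
Proof.
move=> [G [u [lam [degG _ DG <- <-]]]]; exists G, lam; split=> //.
  by apply/bigmax_leqP => v _.
exact: indep_poly_root.
Qed.

End Realizable.

Section Ratio.
Variables (F : fieldType) (D : F -> Prop) (d : nat).

(** Rooted graphs whose root still accepts one edge, with nonzero weight of the
    independent sets avoiding the root, so that the ratio makes sense. *)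
Definition ratio (z : F) : Prop :=
  exists2 a, a != 0 & realizable D d.+1 d a (z * a).

Lemma ratio_leaf z : D z -> ratio z.
Proof.
move=> Dz; exists 1; first exact: oner_neq0.
rewrite mulr1; have [G [u [lam [dG du DG Zo Zi]]]] := realizable_point d.+1 Dz.
by exists G, u, lam; split=> //; exact: leq_trans du _.
Qed.

Lemma ratio_step t z : D t -> 1 + z != 0 -> ratio z -> ratio (t / (1 + z) ^+ d).
Proof.
move=> Dt z1 [a a0 ra]; have ra' := realizable_tree (ltnSn d) (leqnSn d) Dt ra.
have eqa : a + z * a = (1 + z) * a by rewrite mulrDl mul1r.
exists ((1 + z) ^+ d * a ^+ d); first by rewrite mulf_neq0 ?expf_neq0.
by rewrite mulrA divfK ?expf_neq0// -exprMn -eqa.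
Qed.

Lemma ratioN1 : ratio (-1) -> exists (G : sgraph) (lam : G -> F),
  [/\ (max_degree G <= d.+1)%N, forall v, D (lam v) & indep_poly lam = 0].
Proof.
by move=> [a _ /realizable_max_degree]; rewrite mulN1r subrr.
Qed.

End Ratio.

(** * An inequality between sines of multiples *)

Section SineBounds.
Variable R : realType.
Implicit Types (x : R) (n : nat).

Lemma norm_sin_natmul_le n x : `|sin (n%:R * x)| <= n%:R * `|sin x|.
Proof.
elim: n => [|n IHn]; first by rewrite !mul0r sin0 normr0.
rewrite -natr1 mulrDl mul1r sinD (le_trans (ler_normD _ _))// mulrDl mul1r.
rewrite !normrM lerD//.
  by rewrite (le_trans _ IHn)// ler_piMr// cos_max.
by rewrite ler_piMl// cos_max.
Qed.

(** Since sin (u + x) sin (u - x) = sin^2 u - sin^2 x, this amounts to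
    |sin (m x)| <= m |sin x| with m = n + 1.  It says that the sequence
    sin (m x) / (m sin x) is log-concave in m as long as it stays positive. *)
Lemma sin_natmul_log_concave n x :
  n.+1%:R ^+ 2 * (sin (n.+2%:R * x) * sin (n%:R * x))
    <= n%:R * n.+2%:R * sin (n.+1%:R * x) ^+ 2.
Proof.
have -> : sin (n.+2%:R * x) * sin (n%:R * x) = sin (n.+1%:R * x) ^+ 2 - sin x ^+ 2.
  have -> : n.+2%:R * x = n.+1%:R * x + x by rewrite -[n.+2]addn1 natrD; ring.
  have -> : n%:R * x = n.+1%:R * x - x by rewrite -[n.+1]addn1 natrD; ring.
  rewrite sinD sinB.
  transitivity (sin (n.+1%:R * x) ^+ 2 * cos x ^+ 2 - cos (n.+1%:R * x) ^+ 2 * sin x ^+ 2).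
    by ring.
  by rewrite !cos2sin2; ring.
have h : sin (n.+1%:R * x) ^+ 2 <= n.+1%:R ^+ 2 * sin x ^+ 2.
  by rewrite -exprMn -(real_normK (num_real (sin _))) -[leRHS]real_normK ?num_real//
     lerXn2r ?nnegrE// normrM normr_nat norm_sin_natmul_le.
have -> : n%:R * n.+2%:R = n.+1%:R ^+ 2 - 1 :> R.
  by rewrite -[n.+2]addn2 -[n.+1]addn1 !natrD; ring.
by move: h; lra.
Qed.

Lemma sin_natmul_gt0 n x : 0 < x -> n.+2%:R * x <= pi -> 0 < sin (n.+1%:R * x).
Proof.
move=> x0 xpi; apply: sin_gt0_pi; rewrite mulr_gt0// (lt_le_trans _ xpi)//.
by rewrite ltr_pM2r// ltr_nat.
Qed.

(** The quotient of consecutive terms of the sequence sin (m x) / (m sin x),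
    from m = n + 1 to m = n + 2. *)
Let rho n x : R := (n.+1%:R * sin (n.+2%:R * x)) / (n.+2%:R * sin (n.+1%:R * x)).

(** By log-concavity [rho] decreases from [rho 0 x] = cos x < 1.  The right-hand
    side of the last bound is the product of the [n] earlier quotients, each
    of them at least [rho n x]. *)
Lemma sine_ratio_bounds n x : 0 < x -> n.+2%:R * x <= pi ->
  [/\ 0 <= rho n x, rho n x < 1 &
      rho n x ^+ n <= sin (n.+1%:R * x) / (n.+1%:R * sin x)].
Proof.
move=> x0; elim: n => [|n IHn] xpi.
  have s0 := sin_natmul_gt0 x0 xpi; rewrite /rho !mul1r in s0 *.
  rewrite expr0 divff ?gt_eqF//.
  have -> : sin (2 * x) / (2 * sin x) = cos x.
    by rewrite mulr_natl sin_mulr2n -mulr_natl; field; rewrite gt_eqF.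
  split=> //.
    by apply: cos_ge0_pihalf; lra.
  by rewrite -cos0 ltr_cos ?in_itv//=; lra.
have xpi' : n.+2%:R * x <= pi.
  by rewrite (le_trans _ xpi)// ler_pM2r// ler_nat.
have [r0 r1 rn] := IHn xpi'.
have s1 : 0 < sin x.
  apply: sin_gt0_pi; rewrite x0 (lt_le_trans _ xpi')//.
  by rewrite ltr_pMl// ltr1n.
have s2 := sin_natmul_gt0 x0 xpi; have s3 := sin_natmul_gt0 x0 xpi'.
have s4 : 0 <= sin (n.+3%:R * x) by apply: sin_ge0_pi; rewrite xpi mulr_ge0 ?ltW.
have rr : rho n.+1 x <= rho n x.
  rewrite /rho ler_pdivrMr ?mulr_gt0// mulrAC ler_pdivlMr ?mulr_gt0//.
  have := sin_natmul_log_concave n.+1 x.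
  by set a := sin _; set b := sin _; set c := sin _; lra.
split.
- by rewrite /rho divr_ge0// mulr_ge0// ltW.
- exact: le_lt_trans rr r1.
- apply: (le_trans (y := rho n x ^+ n.+1)).
    by rewrite lerXn2r// nnegrE// /rho divr_ge0// mulr_ge0// ltW.
  rewrite exprSr.
  apply: (le_trans (ler_wpM2r r0 rn)); rewrite /rho le_eqVlt; apply/orP; left; apply/eqP.
  by field; rewrite !gt_eqF ?ltr_wpDr.
Qed.

(** With r = [rho n x] and P the product of the earlier quotients, the left-hand
    side is r^(n+2) / P times the right-hand side, and r^n <= P leaves a factor
    at most r^2 < 1. *)
Lemma sine_product_lt n x : 0 < x -> n.+2%:R * x <= pi ->
  sin x / sin (n.+1%:R * x) * (sin (n.+2%:R * x) / sin (n.+1%:R * x)) ^+ n.+2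
    < n.+2%:R ^+ n.+2 / n.+1%:R ^+ n.+3.
Proof.
move=> x0 xpi; have [r0 r1 rn] := sine_ratio_bounds x0 xpi.
have s1 : 0 < sin x.
  apply: sin_gt0_pi; rewrite x0 (lt_le_trans _ xpi)//.
  by rewrite ltr_pMl// ltr1n.
have s2 := sin_natmul_gt0 x0 xpi.
have q : sin (n.+2%:R * x) / sin (n.+1%:R * x) = rho n x * n.+2%:R / n.+1%:R.
  by rewrite /rho; field; rewrite !gt_eqF ?ltr_wpDr.
have c0 : 0 < n.+2%:R ^+ n.+2 / n.+1%:R ^+ n.+3 :> R by rewrite divr_gt0 ?exprn_gt0.
have -> : sin x / sin (n.+1%:R * x) * (sin (n.+2%:R * x) / sin (n.+1%:R * x)) ^+ n.+2
  = rho n x ^+ 2 * (rho n x ^+ n / (sin (n.+1%:R * x) / (n.+1%:R * sin x))) *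
    (n.+2%:R ^+ n.+2 / n.+1%:R ^+ n.+3).
  rewrite q 2!exprMn exprVn -[in rho n x ^+ n.+2]addn2 exprD [in n.+1%:R ^+ n.+3]exprS.
  by field; rewrite !gt_eqF ?exprn_gt0 ?ltr_wpDr.
rewrite gtr_pMl//.
apply: (@le_lt_trans _ _ (rho n x ^+ 2 * 1)).
  by rewrite ler_wpM2l ?sqr_ge0// ler_pdivrMr ?mul1r// divr_gt0// mulr_gt0.
by rewrite mulr1 expr_lt1.
Qed.

End SineBounds.

(** * Propagation along a segment, and polar coordinates *)

Section Polar.
Variable R : realType.
Implicit Types (x y a b c : R) (n : nat).

(** The supremum of the points between [a] and [b] where [P] holds can be neither less
    than [b], since [P] would spread beyond it, nor left out. *)
Lemma segment_induction (P : R -> Prop) a b : a <= b -> P a ->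
  (forall s, a <= s <= b -> \forall p \near (s, s),
     p.1 < b -> P p.1 -> a <= p.2 <= b -> P p.2) -> P b.
Proof.
move=> ab Pa loc.
pose E := [set x | a <= x <= b /\ P x].
have Ea : E a by split=> //; rewrite lexx.
have ubE : has_ubound E by exists b => x [/andP[]].
have supE : has_sup E by split; [exists a|].
have as_ : a <= sup E by apply: ub_le_sup.
have sb : sup E <= b by apply: ge_sup; [exists a|move=> x [/andP[]]].
have /loc : a <= sup E <= b by rewrite as_.
case=> [[U V] /= [/nbhs_ballP[e1 e10 U1] /nbhs_ballP[e2 e20 V2]] UV].
pose e := Num.min e1 e2.
have e0 : 0 < e by rewrite lt_min e10.
have {U1 V2 UV}step x y : `|sup E - x| < e -> `|sup E - y| < e ->
    x < b -> P x -> a <= y <= b -> P y.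
  rewrite !lt_min => /andP[xe1 _] /andP[_ ye2] xb Px yab.
  by apply: (UV (x, y)) => //=; split; [apply: U1|apply: V2].
have [x [xab Px] xs] := sup_adherent e0 supE.
have xle : x <= sup E by apply: ub_le_sup.
have [xb|bx] := ltP x b; last first.
  by have -> : b = x by apply/eqP; rewrite eq_le bx; case/andP: xab.
pose y := Num.min b (sup E + e / 2).
have yle : y <= sup E + e / 2 by rewrite ge_min lexx orbT.
have sy : sup E <= y by rewrite le_min sb lerDl divr_ge0// ltW.
have yb : y <= b by rewrite ge_min lexx.
have Py : P y.
  apply: (step x) => //; last by rewrite yb (le_trans as_).
    by rewrite ger0_norm ?subr_ge0//; move: xs; lra.
  by rewrite ler0_norm ?subr_le0//; move: yle e0; lra.
have : y <= sup E by apply: ub_le_sup => //; split=> //; rewrite yb (le_trans as_).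
rewrite /y ge_min => /orP[bs|]; last by move: e0; lra.
suff <- : y = b by [].
by apply/eqP; rewrite eq_le yb (le_trans bs).
Qed.

Definition cis a : R[i] := cos a +i* sin a.

Lemma cisD a b : cis (a + b) = cis a * cis b.
Proof. by rewrite /cis cosD sinD; simpc; rewrite [X in _ +i* X]addrC. Qed.

Lemma cis0 : cis 0 = 1.
Proof. by rewrite /cis cos0 sin0. Qed.

Lemma cis_neq0 a : cis a != 0.
Proof.
apply/eqP => c0; have := cisD a (- a); rewrite subrr cis0 c0 mul0r.
by move/eqP; rewrite oner_eq0.
Qed.

Lemma cisV a : (cis a)^-1 = cis (- a).
Proof. by apply: (mulfI (cis_neq0 a)); rewrite divff ?cis_neq0// -cisD subrr cis0. Qed.

Lemma cisX a n : cis a ^+ n = cis (n%:R * a).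
Proof.
elim: n => [|n IHn]; first by rewrite mul0r cis0.
by rewrite exprS IHn -cisD -natr1 mulrDl mul1r addrC.
Qed.

Lemma cispi : cis pi = -1.
Proof. by rewrite /cis cospi sinpi; apply/eqP; rewrite eq_complex /= oppr0 !eqxx. Qed.

(** The vertex z of the triangle with vertices -1, 0, z such that 1 + z has
    argument [a] and z has argument [b]; its angle at z is [b - a].  Replacing
    both angles by their opposites gives the conjugate point. *)
Definition apex a b : R[i] := (sin a / sin (b - a))%:C * cis b.

Lemma law_of_sines a b : sin (b - a) != 0 ->
  1 + apex a b = (sin b / sin (b - a))%:C * cis a.
Proof.
move=> s0; rewrite /apex /cis.
apply/eqP; rewrite eq_complex /=; simpc; apply/andP; split; apply/eqP.
  rewrite -[1](divff s0) sinB; field; by rewrite -sinB.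
by field.
Qed.

Lemma add1_apex_neq0 a b : sin (b - a) != 0 -> sin b != 0 -> 1 + apex a b != 0.
Proof.
move=> sba sb; rewrite law_of_sines// mulf_neq0 ?cis_neq0//.
by rewrite eq_complex /= eqxx andbT mulf_neq0 ?invr_neq0.
Qed.

(** The argument of t / (1 + z)^n, for t > 0, is fixed by that of 1 + z; only the
    modulus can be chosen, that is, the angle [c] at -1 of the new triangle. *)
Lemma apex_step n a b c : sin b != 0 -> sin (b - a) != 0 ->
  (sin c / sin (- (n%:R * a) - c) * (sin b / sin (b - a)) ^+ n)%:C / (1 + apex a b) ^+ n
    = apex c (- (n%:R * a)).
Proof.
move=> sb sba; rewrite law_of_sines// [X in _ / X]exprMn cisX invfM cisV /apex.
rewrite -rmorphXn/= mulrA -fmorphV -rmorphM/= mulfK//.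
by rewrite expf_neq0// mulf_neq0// invr_neq0.
Qed.

End Polar.

(** * Limits *)

Section Limits.
Variable R : realType.

Lemma near_complex (T : Type) (F : set_system T) {FF : Filter F} (f g : T -> R)
    (a b : R) (D : set R[i]^o) :
  f @ F --> a -> g @ F --> b -> nbhs (a +i* b : R[i]^o) D ->
  \forall t \near F, D (f t +i* g t).
Proof.
move=> fa gb /nbhs_ballP[[r i] /= e0 eD].
have [i0 r0] : i = 0 /\ 0 < r by move: e0; rewrite ltcE /= => /andP[/eqP].
have r2 : 0 < r / 2 by rewrite divr_gt0.
have fn := cvgr_dist_lt (FF := FF) f a fa _ r2.
have gn := cvgr_dist_lt (FF := FF) g b gb _ r2.
apply: filterS2 fn gn => t ft gt; apply: eD.
rewrite -ball_normE /ball_ /=; move: gt ft.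
set v := b - _; set u := a - _ => hv hu.
rewrite normc_def /= i0 ltcR.
rewrite -(ger0_norm (ltW r0)) -sqrtr_sqr ltr_sqrt ?exprn_gt0//.
rewrite -(real_normK (num_real u)) -(real_normK (num_real v)).
have : `|u| ^+ 2 < (r / 2) ^+ 2 by rewrite ltrXn2r ?nnegrE// ltW.
have : `|v| ^+ 2 < (r / 2) ^+ 2 by rewrite ltrXn2r ?nnegrE// ltW.
have r3 : 0 < r ^+ 2 by rewrite exprn_gt0.
by rewrite expr_div_n; lra.
Qed.

(** The Chebyshev polynomial of the second kind U_(k-1) evaluated at cos x.  It
    extends sin (k x) / sin x continuously to x = 0. *)
Fixpoint sinU (k : nat) (x : R) : R :=
  if k is k'.+1 then sinU k' x * cos x + cos (k'%:R * x) else 0.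

Lemma sinUE k x : sin (k%:R * x) = sinU k x * sin x.
Proof.
elim: k => [|k IHk]; first by rewrite !mul0r sin0.
by rewrite -natr1 mulrDl mul1r sinD IHk /=; ring.
Qed.

Lemma sinU0 k : sinU k 0 = k%:R.
Proof. by elim: k => //= k ->; rewrite mulr0 cos0 mulr1 natr1. Qed.

Lemma cvg_cos_comp (T : Type) (F : set_system T) {FF : Filter F} (f : T -> R) (a : R) :
  f @ F --> a -> cos (f t) @[t --> F] --> cos a.
Proof. by move=> fa; apply: continuous_cvg => //; exact: continuous_cos. Qed.

Lemma cvg_sin_comp (T : Type) (F : set_system T) {FF : Filter F} (f : T -> R) (a : R) :
  f @ F --> a -> sin (f t) @[t --> F] --> sin a.
Proof. by move=> fa; apply: continuous_cvg => //; exact: continuous_sin. Qed.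

Lemma continuous_sinU k : continuous (sinU k).
Proof.
move=> x; elim: k => [|k IHk] /=; first exact: cvg_cst.
apply: cvgD; first by apply: cvgM => //; exact: continuous_cos.
by apply: cvg_cos_comp; apply: cvgM; [exact: cvg_cst|exact: cvg_id].
Qed.

Lemma cvg_exprn (T : Type) (F : set_system T) {FF : Filter F} (f : T -> R) (a : R) n :
  f @ F --> a -> f t ^+ n @[t --> F] --> a ^+ n.
Proof. by move=> fa; exact: (cvg_comp _ _ fa (@exprn_continuous R n a)). Qed.

End Limits.

(** * Moving the ratio from the real interval to -1 *)

Section Main.
Variables (R : realType) (n : nat) (D : set R[i]^o).
Let lamc : R := n.+2%:R ^+ n.+2 / n.+1%:R ^+ n.+3.
Hypothesis hD : set_nbhs (real_seg lamc) D.

Lemma real_in_nbhs t : 0 <= t < lamc -> nbhs (t%:C : R[i]^o) D.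
Proof. by move=> tl; apply: hD; exists t => //=; rewrite in_itv. Qed.

Let z x : R[i] := apex x (n.+2%:R * x).

Lemma natmulSB (x : R) : n.+2%:R * x - x = n.+1%:R * x.
Proof. by rewrite -natr1 mulrDl mul1r addrK. Qed.

(** As x decreases to 0, z(x) tends to 1 / (n + 1), which is less than [lamc]. *)
Lemma initial_apex : exists2 x, 0 < x <= pi / n.+2%:R & D (z x).
Proof.
have cl : 0 <= (n.+1%:R^-1 : R) < lamc.
  rewrite invr_ge0 ler0n /lamc [n.+1%:R ^+ _]exprS invfM mulrCA ltr_pMr ?invr_gt0//.
  by rewrite ltr_pdivlMr ?exprn_gt0// mul1r ltrXn2r ?nnegrE// ltr_nat.
have U0 : (sinU n.+1 x)^-1 @[x --> 0^'+] --> (n.+1%:R^-1 : R).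
  apply: cvg_at_right_filter; apply: cvgV; first by rewrite pnatr_eq0.
  by rewrite -[X in _ --> X](@sinU0 R); exact: continuous_sinU.
have d0 : (n.+2%:R * x : R) @[x --> 0^'+] --> (0 : R).
  apply: cvg_at_right_filter; rewrite -[X in _ --> X](mulr0 (n.+2%:R : R)).
  by apply: cvgM; [exact: cvg_cst|exact: cvg_id].
pose proof (cvgM U0 (cvg_cos_comp d0)) as c0.
pose proof (cvgM U0 (cvg_sin_comp d0)) as s0.
rewrite cos0 mulr1 in c0; rewrite sin0 mulr0 in s0.
pose proof (near_complex c0 s0 (real_in_nbhs cl)) as nearD.
near (0:R)^'+ => x.
have x0 : 0 < x by near: x; exact: nbhs_right_gt.
have xpi : x < pi / n.+2%:R by near: x; apply: nbhs_right_lt; rewrite divr_gt0// pi_gt0.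
exists x; first by rewrite x0 ltW.
have : D ((sinU n.+1 x)^-1 * cos (n.+2%:R * x) +i* ((sinU n.+1 x)^-1 * sin (n.+2%:R * x))).
  by near: x.
congr D; rewrite /z /apex natmulSB.
have sx : sin x != 0.
  rewrite gt_eqF// sin_gt0_pi// x0 (lt_le_trans xpi)// ler_pdivrMr// ler_peMr ?pi_ge0//.
  by rewrite ler1n.
rewrite (sinUE n.+1) invfM mulrCA divff// mulr1.
by rewrite /cis; simpc.
Unshelve. all: by end_near. Qed.

(** The first step goes to the point of argument - (n + 2) x for which 1 + z has
    argument - y, and the second one from there to z(y).  The last two
    inequalities bound the parameters of these steps. *)
Lemma ratio_apex_step (x y : R) :
  0 < x < pi / n.+2%:R -> 0 < sin (n.+1%:R * x) -> 0 < sin y ->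
  0 < sin (n.+1%:R * y) -> 0 < sin (n.+2%:R * x - y) ->
  sin y / sin (n.+2%:R * x - y) * (sin (n.+2%:R * x) / sin (n.+1%:R * x)) ^+ n.+2 < lamc ->
  sin y / sin (n.+1%:R * y) * (sin (n.+2%:R * x) / sin (n.+2%:R * x - y)) ^+ n.+2 < lamc ->
  ratio D n.+2 (z x) -> ratio D n.+2 (z y).
Proof.
move=> /andP[x0 xpi] skx sy sky sxy t1 t2 rx.
have sdx : 0 < sin (n.+2%:R * x).
  by apply: sin_gt0_pi; rewrite mulr_gt0//= mulrC -ltr_pdivlMr.
have Dt t : 0 <= t < lamc -> D t%:C by move/real_in_nbhs/nbhs_singleton.
have r1 : ratio D n.+2 (apex (- y) (- (n.+2%:R * x))).
  rewrite -(@apex_step R n.+2 x (n.+2%:R * x)) ?natmulSB ?gt_eqF//.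
  apply: ratio_step => //.
    apply: Dt; have -> : - (n.+2%:R * x) - - y = - (n.+2%:R * x - y) by ring.
    by rewrite !sinN invrN mulrNN t1 andbT mulr_ge0 ?exprn_ge0 ?divr_ge0// ltW.
  by apply: add1_apex_neq0; rewrite ?natmulSB ?gt_eqF.
have sN : sin (- (n.+2%:R * x) - - y) = - sin (n.+2%:R * x - y).
  by rewrite -sinN; congr sin; ring.
rewrite /z; have -> : n.+2%:R * y = - (n.+2%:R * - y) by ring.
rewrite -(@apex_step R n.+2 (- y) (- (n.+2%:R * x))) ?sN ?sinN ?oppr_eq0 ?gt_eqF//.
apply: ratio_step => //.
  apply: Dt; have -> : - (n.+2%:R * - y) - y = n.+1%:R * y by rewrite -natmulSB; ring.
  by rewrite invrN mulrNN t2 andbT mulr_ge0 ?exprn_ge0 ?divr_ge0// ltW.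
by apply: add1_apex_neq0; rewrite ?sN ?sinN ?oppr_eq0 ?gt_eqF.
Qed.

(** At x = y = s both parameters of [ratio_apex_step] are equal to the number
    bounded in [sine_product_lt], and they depend continuously on (x, y).  The
    point x = pi / (n + 2) is excluded because there 1 + z(x) = 0, but
    y = pi / (n + 2) is allowed. *)
Lemma ratio_apex_near s : 0 < s <= pi / n.+2%:R ->
  \forall p \near (s, s), p.1 < pi / n.+2%:R -> ratio D n.+2 (z p.1) ->
    ratio D n.+2 (z p.2).
Proof.
move=> /andP[s0 spi].
have dspi : n.+2%:R * s <= pi by rewrite mulrC -ler_pdivlMr.
have := sine_product_lt s0 dspi; rewrite -/lamc => lts.
have sks := sin_natmul_gt0 s0 dspi.
have ss : 0 < sin s.
  apply: sin_gt0_pi; rewrite s0 (lt_le_trans _ dspi)//.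
  by rewrite ltr_pMl// ltr1n.
have c1 : (p.1 : R) @[p --> (s, s)] --> s by exact: cvg_fst.
have c2 : (p.2 : R) @[p --> (s, s)] --> s by exact: cvg_snd.
have cM m (f : R * R -> R) : f p @[p --> (s, s)] --> s ->
    m%:R * f p @[p --> (s, s)] --> m%:R * s.
  by move=> fs; apply: cvgM => //; exact: cvg_cst.
pose proof (cvg_sin_comp c2) as cs2.
pose proof (cvg_sin_comp (cM n.+2 _ c1)) as csd1.
pose proof (cvg_sin_comp (cM n.+1 _ c1)) as csk1.
pose proof (cvg_sin_comp (cM n.+1 _ c2)) as csk2.
pose proof (cvg_sin_comp (cvgB (cM n.+2 _ c1) c2)) as csB; rewrite natmulSB in csB.
have neq0 := lt0r_neq0 sks.
pose proof (cvgM (cvgM cs2 (cvgV neq0 csB)) (cvg_exprn (n := n.+2) (cvgM csd1 (cvgV neq0 csk1)))) as T1.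
pose proof (cvgM (cvgM cs2 (cvgV neq0 csk2)) (cvg_exprn (n := n.+2) (cvgM csd1 (cvgV neq0 csB)))) as T2.
near=> p => ppi.
apply: ratio_apex_step.
- by rewrite ppi andbT; near: p; exact: (cvgr_gt _ c1).
- by near: p; exact: (cvgr_gt _ csk1).
- by near: p; exact: (cvgr_gt _ cs2).
- by near: p; exact: (cvgr_gt _ csk2).
- by near: p; exact: (cvgr_gt _ csB).
- by near: p; exact: (cvgr_lt _ T1).
- by near: p; exact: (cvgr_lt _ T2).
Unshelve. all: by end_near. Qed.

Lemma apex_pi : z (pi / n.+2%:R) = -1.
Proof.
have dpi : n.+2%:R * (pi / n.+2%:R) = pi :> R by rewrite mulrC divfK ?pnatr_eq0.
rewrite /z /apex dpi cispi sinB sinpi cospi mul0r sub0r mulN1r opprK.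
rewrite divff ?mul1r// gt_eqF// sin_gt0_pi// divr_gt0 ?pi_gt0//=.
by rewrite ltr_pdivrMr// ltr_pMr ?pi_gt0// ltr1n.
Qed.

Lemma ratioN1_reached : ratio D n.+2 (-1).
Proof.
have [x0 /andP[x0_gt0 x0_le] Dx0] := initial_apex.
rewrite -apex_pi; apply: (segment_induction (P := ratio D n.+2 \o z) x0_le).
  exact: ratio_leaf.
move=> s /andP[x0s spi].
have s_in : 0 < s <= pi / n.+2%:R by rewrite spi (lt_le_trans x0_gt0).
by apply: filterS (ratio_apex_near s_in) => p hp p1 r1 _; exact: hp.
Qed.

End Main.

Theorem theoremA7 (R : realType) (Delta : nat) (hDelta : (3 <= Delta)%N)
    (D : set R[i]^o) (hD : set_nbhs (real_seg (lambda_crit R Delta)) D) :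
  exists (G : sgraph) (lam : G -> R[i]),
    [/\ (max_degree G <= Delta)%N,
        forall v : G, D (lam v) &
        indep_poly lam = 0].
Proof.
case: Delta hDelta hD => [|[|[|n]]]// _.
have -> : lambda_crit R n.+3 = n.+2%:R ^+ n.+2 / n.+1%:R ^+ n.+3.
  have e1 : n.+3%:R - 1 = n.+2%:R :> R by rewrite -natr1 addrK.
  have e2 : n.+3%:R - 2 = n.+1%:R :> R by rewrite -[n.+3]addn2 natrD addrK.
  by rewrite /lambda_crit e1 e2 subn1.
by move=> /ratioN1_reached/ratioN1.
Qed.
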